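(* Let $G$ be a finite reflexive undirected graph. Then \[ c(G)\leq 2\min_{T}\Big\{\max_{B\in T}\mathrm{rcc}_G(\langle B\rangle)\Big\}, \] where the minimum ranges over all tree decompositions $T$ of $G$, the maximum ranges over all bags $B$ of $T$, and $\langle B\rangle$ denotes the subgraph of $G$ induced by $B$.
   Context: Graphs are finite, undirected and reflexive (every vertex has a loop). Cops and Robbers: a set of cops and a single robber occupy vertices; the cops first choose initial vertices, then the robber chooses his initial vertex, and then the players alternate, the cops moving first. On a move, each cop (any subset of the cops may move) and, on his turn, the robber moves to a neighbouring vertex or stays put (passing is allowed because of the loops). The cops win if after finitely many rounds some cop occupies the same vertex as the robber (capture); the robber wins if he evades capture forever. The cop number $c(G)$ is the minimum number of cops that have a winning strategy on $G$. An induced subgraph $H$ of $G$ is a retract if there is a graph homomorphism $f$ from $G$ onto $H$ with $f(x)=x$ for all $x\in V(H)$. For a retract $H$, $\mathrm{guard}(H)$ is the minimum number of cops that, playing in $G$, can ensure that after finitely many rounds, if the robber ever moves onto a vertex of $H$ he is immediately captured (on the cops' next move); this is well defined since placing a cop on each vertex of $H$ suffices. For an induced subgraph $H$ of $G$, a retract cover of $H$ in $G$ is a set $\{H_i: i\in I\}$ of induced subgraphs of $G$, each a retract of $G$ (not necessarily disjoint), whose union contains $H$. The retract cover cop number is $\mathrm{rcc}_G(H)=\min \sum_{i\in I}\mathrm{guard}(H_i)$, the minimum over all retract covers $\{H_i\}$ of $H$ in $G$. A tree decomposition of $G=(V,E)$ is a pair consisting of a family of subsets (bags) $X_1,\dots,X_n$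 of $V$ and a tree $T$ whose vertices are the bags, such that: (1) $V=\bigcup_i X_i$; (2) for every edge $vw$ of $G$ some bag contains both $v$ and $w$; (3) if $X_k$ lies on the path in $T$ from $X_i$ to $X_j$ then $X_i\cap X_j\subseteq X_k$.
   Formalization: The graph G is additionally assumed connected; without this the inequality fails, e.g. for three isolated looped vertices, where c(G)=3 but the path of singleton bags makes the right-hand side at most 2. *)

(* Defs.v *)
From mathcomp Require Import all_boot.
From mathcomp Require Import boolp.

Set Implicit Arguments.
Unset Strict Implicit.
Unset Printing Implicit Defensive.

Record graph := Graph {
  vertex :> finType;
  adj : rel vertex;
  adj_refl : reflexive adj;
  adj_sym : symmetric adj }.

Definition connected_graph (G : graph) : Prop :=
  forall x y : G, connect (@adj G) x y.

(* If the robber successively occupies r 0, r 1, ..., then the cops following  *)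
(* s start from s [::] and, after n cop moves, occupy s [:: r 0; ...; r n.-1]. *)
(* The order of play is: s [::], r 0, s [:: r 0], r 1, s [:: r 0; r 1], ...    *)
Definition strategy (G : graph) (k : nat) := seq G -> {ffun 'I_k -> G}.

Definition legal (G : graph) (k : nat) (s : strategy G k) : Prop :=
  forall (h : seq G) (v : G) (i : 'I_k), adj (s h i) (s (rcons h v) i).

Definition robber_walk (G : graph) (r : nat -> G) : Prop :=
  forall n, adj (r n) (r n.+1).

(* The robber standing at r n either has moved onto a cop or is captured by *)
(* the cop move that follows.                                               *)
Definition caught (G : graph) (k : nat) (s : strategy G k) (r : nat -> G)
    (n : nat) : Prop :=
  exists i : 'I_k, s (mkseq r n) i = r n \/ s (mkseq r n.+1) i = r n.

Definition cops_win (G : graph) (k : nat) : Prop :=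
  exists s : strategy G k, legal s /\
    forall r : nat -> G, robber_walk r -> exists n, caught s r n.

Lemma cops_win_ex (G : graph) : exists k, `[< cops_win G k >].
Proof.
exists #|G|; apply/asboolP.
exists (fun=> [ffun i => enum_val i]); split=> [h v i|r _].
  exact: adj_refl.
by exists 0, (enum_rank (r 0)); left; rewrite ffunE enum_rankK.
Qed.

Definition cop_number (G : graph) : nat := ex_minn (cops_win_ex G).

(* The bound N on the number of preliminary rounds precedes the choice of the *)
(* robber's walk. Staying put in H counts as moving (along a loop) onto H.    *)
(* The play is over once the robber has been captured.                        *)
Definition can_guard (G : graph) (H : {set G}) (k : nat) : Prop :=
  exists s : strategy G k, legal s /\
    exists N : nat, forall r : nat -> G, robber_walk r ->
      forall n, N <= n -> (forall m, m < n -> ~ caught s r m) ->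
        r n \in H -> caught s r n.

Lemma can_guard_ex (G : graph) (H : {set G}) :
  exists k, `[< can_guard H k >].
Proof.
exists #|H|; apply/asboolP.
exists (fun=> [ffun i => enum_val i]); split=> [h v i|].
  exact: adj_refl.
exists 0 => r _ n _ _ rnH.
by exists (enum_rank_in rnH (r n)); left; rewrite ffunE enum_rankK_in.
Qed.

Definition guard (G : graph) (H : {set G}) : nat := ex_minn (can_guard_ex H).

(* Induced subgraphs are represented by their vertex sets. *)
Definition retract (G : graph) (H : {set G}) : Prop :=
  exists f : G -> G,
    [/\ forall x y, adj x y -> adj (f x) (f y),
        forall x, f x \in H
      & forall x, x \in H -> f x = x].

Definition retract_cover (G : graph) (B : {set G}) (C : {set {set G}}) : Prop :=
  (forall H, H \in C -> retract H) /\ B \subset cover C.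

Definition rcc_value (G : graph) (B : {set G}) (n : nat) : Prop :=
  exists C : {set {set G}}, retract_cover B C /\ \sum_(H in C) guard H = n.

Lemma rcc_value_ex (G : graph) (B : {set G}) :
  exists n, `[< rcc_value B n >].
Proof.
exists (\sum_(H in [set [set: G]]) guard H); apply/asboolP.
exists [set [set: G]]; split=> //; split=> [H|].
  by rewrite inE => /eqP ->; exists id; split=> // x; rewrite inE.
by rewrite /cover big_set1 subsetT.
Qed.

Definition rcc (G : graph) (B : {set G}) : nat := ex_minn (rcc_value_ex B).

Definition is_tree (I : finType) (t : rel I) : Prop :=
  [/\ 0 < #|I|, symmetric t, irreflexive t,
      forall i j, connect t i j
    & forall c : seq I, 2 < size c -> ~ ucycle t c].

Record tree_decomposition (G : graph) := TreeDecomposition {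
  td_size : nat;
  bag : 'I_td_size -> {set G};
  td_tree : rel 'I_td_size;
  td_is_tree : is_tree td_tree;
  td_vertex : forall v : G, exists i, v \in bag i;
  td_edge : forall v w : G, adj v w -> exists i, (v \in bag i) && (w \in bag i);
  td_path : forall (i : 'I_td_size) (p : seq 'I_td_size) (k : 'I_td_size),
    path td_tree i p -> uniq (i :: p) -> k \in i :: p ->
    bag i :&: bag (last i p) \subset bag k }.

Definition rcc_width (G : graph) (D : tree_decomposition G) : nat :=
  \max_(i < td_size D) rcc (bag i).

Lemma rcc_width_ex (G : graph) :
  exists n, `[< exists D : tree_decomposition G, rcc_width D = n >].
Proof.
have tree1 : is_tree (fun _ _ : 'I_1 => false).
  split=> // [|i j|c lt2c].
  - by rewrite card_ord.
  - by rewrite (ord1 i) (ord1 j) connect0.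
  - case/andP=> _ /card_uniqP c_size.
    by have := max_card (mem c); rewrite card_ord c_size leqNgt (ltnW lt2c).
unshelve eexists (rcc_width
  (@TreeDecomposition G 1 (fun=> setT) (fun _ _ => false) tree1 _ _ _)).
- by move=> v; exists ord0; rewrite inE.
- by move=> v w _; exists ord0; rewrite !inE.
- by move=> *; apply: subsetT.
by apply/asboolP; eexists.
Qed.

Definition min_rcc_width (G : graph) : nat := ex_minn (rcc_width_ex G).

(* Main.v *)
(* Two teams of [min_rcc_width G] cops alternate. While one team guards a bag   *)
(* [i], the robber cannot enter it, so he is confined to the bags of one branch *)
(* of the tree at [i], say the one through the neighbour [j] of [i]. The other  *)
(* team then travels to the bag [j] and starts guarding it; this confines the   *)
(* robber to a strictly smaller branch at [j], and the first team is released.  *)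
Require Import Defs.
From mathcomp Require Import all_boot.
From mathcomp Require Import boolp.

Set Implicit Arguments.
Unset Strict Implicit.
Unset Printing Implicit Defensive.

(** Fix an optimal decomposition. Adding up the guards of an optimal retract cover,
    [min_rcc_width G] cops can guard any single bag ([can_guard_rcc]). The bags containing a given
    vertex span a subtree, so a robber who keeps out of bag [i] cannot leave the component of the
    tree minus [i] that holds his bags ([confined_adj]). Passing the guard from [i] to a neighbour
    [j] without a gap ([win_takeover]) puts him in a strictly smaller component, because the tree is
    acyclic ([branch_proper]); [win_branch] is the resulting induction. It runs on positions,
    through the inductive predicate [win], and [win_strategy] turns the outcome into strategies on
    histories. *)

Section Trees.

(** * Components of a tree minus a vertex *)

Variables (I : finType) (t : rel I).

Definition away (i : I) : rel I := fun x y => [&& t x y, x != i & y != i].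

Definition branch (i j : I) : {set I} := [set k | connect (away i) j k].

(** The case [nilp p] is needed because an empty path uses no edge and so is allowed even when [x]
    is [i]. *)
Lemma path_away i x p :
  path (away i) x p = path t x p && (i \notin x :: p) || nilp p.
Proof.
elim: p x => [|y p IHp] x /=; first by rewrite orbT.
rewrite IHp orbF /away !inE !negb_or ![i == _]eq_sym.
case: (t x y); case: (x == i); case: (y == i); rewrite ?andbF //=.
by case: p {IHp} => [|z p]; rewrite ?orbF.
Qed.

(** A simple path never returns to [j] after its first step. The relation [e] is [t] itself at the
    start of the chase and [away i] afterwards, so that the first step then avoids [i]. *)
Lemma connect_first_step (e : rel I) j k : subrel e t -> connect e j k ->
  k != j -> exists2 j', e j j' & k \in branch j j'.
Proof.
move=> sub_et /connectP[p0 e_p0 ->]; case/shortenP: e_p0 => -[|j' p] //=.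
  by rewrite eqxx.
case/andP=> e_jj' e_p /andP[jp _] _ _; exists j' => //.
rewrite inE; apply/connectP; exists p => //.
by rewrite path_away (sub_path sub_et e_p) jp.
Qed.

(** A path from [j'] to [i] avoiding [j] would close up to a cycle through [j]. So paths from [j']
    off [j] also miss [i], which gives the inclusion; it is strict because [j] is lost. *)
Lemma branch_proper i j j' : is_tree t -> t i j -> away i j j' ->
  branch j j' \proper branch i j.
Proof.
case=> _ symt irrt _ acyc tij /and3P[tjj' ji j'i].
have iN : i \notin branch j j'.
  rewrite inE; apply/negP => /connectP[p0 e_p0 Ei].
  move: Ei; case/shortenP: e_p0 => -[|x p] e_p Up _ Ei.
    by rewrite Ei eqxx in j'i.
  move: e_p; rewrite path_away orbF => /andP[t_p jp].
  apply: (acyc [:: j, j', x & p]) => //; apply/andP; split; last first.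
    by rewrite cons_uniq jp.
  by rewrite (cycle_path j) /= -[last x p]/(last j' (x :: p)) -Ei tij tjj'.
have jN : j \notin branch j j'.
  rewrite inE; apply/negP => /connectP[[|x p]] e_p Ej.
    by move: tjj'; rewrite Ej irrt.
  move: e_p; rewrite path_away orbF => /andP[_ /negP[]].
  by rewrite {1}Ej mem_last.
apply/properP; split; last by exists j; rewrite // inE connect0.
apply/subsetP => x; rewrite !inE => cx.
apply: (@connect_trans _ _ j'); first by apply: connect1; apply/and3P.
case/connectP: cx => p e_p ->; apply/connectP; exists p => //.
case: p e_p => [//|y p] e_p; rewrite path_away orbF.
move: (e_p); rewrite path_away orbF => /andP[-> _] /=.
by apply: contra iN => ip; rewrite inE (path_connect e_p).
Qed.

End Trees.

(** * Confinement of the robber by a bag *)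

Section Bags.
Variables (G : graph) (D : tree_decomposition G).

(** Every bag on the tree path from [k] to [l] contains [v], so [i] is not on that path. *)
Lemma bags_connected (v : G) i k l :
    v \in bag k -> v \in bag l -> v \notin @bag G D i ->
  connect (away (@td_tree G D) i) k l.
Proof.
move=> vk vl vi; have [_ _ _ cT _] := td_is_tree D.
have /connectP[p0 e_p0 El] := cT k l.
move: El; case/shortenP: e_p0 => p e_p Up _ El; apply/connectP; exists p => //.
rewrite path_away e_p /=; apply/orP; left; apply: contra vi => ip.
by apply: (subsetP (td_path e_p Up ip)); rewrite inE vk -El.
Qed.

Definition confined i j (v : G) : Prop :=
  exists2 k, v \in bag k & k \in branch (@td_tree G D) i j.

Lemma confined_adj i j v w :
  v \notin bag i -> adj v w -> confined i j v -> confined i j w.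
Proof.
move=> vi /(@td_edge G D)[l /andP[vl wl]] [k vk]; rewrite inE => jk.
by exists l => //; rewrite inE (connect_trans jk) // (bags_connected vk vl vi).
Qed.

End Bags.

(** * Joining teams of cops *)

Section Game.
Variable G : graph.

Definition moves k (a a' : {ffun 'I_k -> G}) := forall i, adj (a i) (a' i).

Definition occupied k (a : {ffun 'I_k -> G}) (v : G) := exists i, a i = v.

Definition join k l (a : {ffun 'I_k -> G}) (d : {ffun 'I_l -> G}) :
    {ffun 'I_(k + l) -> G} :=
  [ffun i => match split i with inl x => a x | inr y => d y end].

Lemma occupied_join k l (a : {ffun 'I_k -> G}) (d : {ffun 'I_l -> G}) v :
  occupied (join a d) v <-> occupied a v \/ occupied d v.
Proof.
split=> [[i]|[] [i <-]].
- by rewrite ffunE; case: (split i) => x <-; [left|right]; exists x.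
- by exists (lshift l i); rewrite ffunE (unsplitK (inl _ i)).
- by exists (rshift k i); rewrite ffunE (unsplitK (inr _ i)).
Qed.

Lemma moves_join k l (a a' : {ffun 'I_k -> G}) (d d' : {ffun 'I_l -> G}) :
  moves a a' -> moves d d' -> moves (join a d) (join a' d').
Proof. by move=> aa dd i; rewrite !ffunE; case: (split i). Qed.

Lemma moves_refl k (a : {ffun 'I_k -> G}) : moves a a.
Proof. by move=> i; apply: adj_refl. Qed.

Lemma mkseq_cons (r : nat -> G) n :
  mkseq r n.+1 = r 0 :: mkseq (fun m => r m.+1) n.
Proof. by rewrite /mkseq /= (iotaDl 1) -map_comp. Qed.

Lemma caughtE k (s : strategy G k) r n :
  caught s r n <->
  occupied (s (mkseq r n)) (r n) \/ occupied (s (mkseq r n.+1)) (r n).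
Proof. by split=> [[i []]|[] [i]]; [left|right| |]; exists i; auto. Qed.

Lemma can_guard_join A B k l :
  can_guard A k -> can_guard B l -> @can_guard G (A :|: B) (k + l).
Proof.
move=> [s [s_legal [M sM]]] [u [u_legal [N uN]]].
pose w h := join (s h) (u h); exists w; split=> [h v|].
  exact: (moves_join (s_legal h v) (u_legal h v)).
have caught_w r n : caught s r n \/ caught u r n -> caught w r n.
  by rewrite !caughtE !occupied_join; tauto.
exists (maxn M N) => r walk_r n; rewrite geq_max => /andP[Mn Nn] free.
case/setUP => rn; apply: (caught_w).
  by left; apply: sM => // m mn c; apply: (free m mn); apply: (caught_w); left.
by right; apply: uN => // m mn c; apply: (free m mn); apply: (caught_w); right.
Qed.

Lemma can_guard_set0 k (a : {ffun 'I_k -> G}) : can_guard (set0 : {set G}) k.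
Proof.
exists (fun=> a); split=> [h v i|]; first exact: adj_refl.
by exists 0 => r _ n _ _; rewrite inE.
Qed.

Lemma can_guard_guard (H : {set G}) : can_guard H (guard H).
Proof. by rewrite /guard; case: ex_minnP => n /asboolP. Qed.

Lemma can_guard_rcc (x : G) (B : {set G}) k : rcc B <= k -> can_guard B k.
Proof.
have const l : {ffun 'I_l -> G} := [ffun=> x].
rewrite /rcc; case: ex_minnP => n /asboolP[C [[_ BC] <-]] _ Ck.
have [s [s_legal [N sN]]] : can_guard (cover C) k.
  (* The cops in excess of the cost of the cover stand idle at [x], as a team guarding the empty
     set. *)
  rewrite -(subnKC Ck) -[cover C]setU0; apply: can_guard_join.
    rewrite /cover; elim/big_ind2: _ => [|A n1 B' n2|H _].
    - exact: can_guard_set0 (const 0).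
    - exact: can_guard_join.
    - exact: can_guard_guard.
  exact: can_guard_set0 (const _).
exists s; split=> //; exists N => r walk_r m Nm free rB.
exact: sN walk_r m Nm free (subsetP BC _ rB).
Qed.

(** * Winning positions, with the cops to move, and strategies *)

Inductive win k : {ffun 'I_k -> G} -> G -> Prop :=
| win_now a v : occupied a v -> win a v
| win_move a a' v : moves a a' ->
    (~ occupied a' v -> forall v', adj v v' -> win a' v') -> win a v.

(** The vertex [v] stays in the history passed to [S v], for which it is the robber's initial
    vertex. *)
Definition strategy_cons k (a : {ffun 'I_k -> G}) (S : G -> strategy G k) :
    strategy G k :=
  fun h => if h is v :: _ then S v h else a.

Lemma strategy_cons_legal k (a : {ffun 'I_k -> G}) S :
    (forall v, legal (S v) /\ S v [::] = a) ->
  legal (strategy_cons a S).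
Proof.
move=> S_legal [|x h] v i /=; last by rewrite -rcons_cons; apply: (S_legal x).1.
by rewrite -{1}(S_legal v).2; apply: (S_legal v).1.
Qed.

Lemma win_strategy k (a : {ffun 'I_k -> G}) v : win a v ->
  exists s : strategy G k, [/\ legal s, s [::] = a &
    forall r, robber_walk r -> r 0 = v -> exists n, caught s r n].
Proof.
elim=> {a v} [a v av|a a' v aa' _ IH].
  exists (fun=> a); split=> // [h w i|r _ r0]; first exact: adj_refl.
  by exists 0; rewrite caughtE r0; left.
have [occ|free] := pselect (occupied a' v).
  exists (fun h => if h is _ :: _ then a' else a); split=> //.
    by case=> [|x h] w i //=; apply: adj_refl.
  by move=> r _ r0; exists 0; rewrite caughtE r0; right.
(* Choice needs a strategy for every [v']; an idle one serves when [v'] is not a neighbour of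
   [v]. *)
have /choice[S S_spec] : forall v', exists s : strategy G k,
    (legal s /\ s [::] = a') /\ (adj v v' ->
      forall r, robber_walk r -> r 0 = v' -> exists n, caught s r n).
  move=> v'; have [vv'|/negP nvv'] := boolP (adj v v').
    by have [s [s1 s2 s3]] := IH free v' vv'; exists s.
  by exists (fun=> a'); split=> //; split=> // h w i; apply: adj_refl.
exists (fun h => if h is _ :: h' then strategy_cons a' S h' else a); split=> //.
  case=> [|x h] w i //=; apply: strategy_cons_legal => u.
  exact: (S_spec u).1.
move=> r walk_r r0; have adj01 : adj v (r 1) by rewrite -r0.
have [n] := (S_spec _).2 adj01 (fun m => r m.+1) (fun m => walk_r m.+1) erefl.
rewrite caughtE => c; exists n.+1; rewrite caughtE 2!(mkseq_cons r).
case: n c => [|n]; rewrite !mkseq_cons //=.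
by rewrite (S_spec _).1.2.
Qed.

Lemma cops_win_from k (a : {ffun 'I_k -> G}) :
  (forall v, win a v) -> cops_win G k.
Proof.
move=> /(_ _)/win_strategy win_a; have [S S_spec] := choice win_a.
exists (strategy_cons a S); split.
  by apply: strategy_cons_legal => v; case: (S_spec v).
move=> r walk_r; have [_ S0 S_win] := S_spec (r 0).
have [n] := S_win r walk_r erefl.
by rewrite caughtE => c; exists n; rewrite caughtE; case: n c => [|n];
  rewrite !mkseq_cons //= S0.
Qed.

(* The cops at [a] are to move and the robber is at [v]; rounds are counted *)
(* from this position.                                                      *)
Definition guards k n (A : {set G}) (a : {ffun 'I_k -> G}) (v : G) : Prop :=
  exists s : strategy G k, [/\ legal s, s [::] = a &
    forall r, robber_walk r -> r 0 = v ->
      forall m, n <= m -> (forall l, l < m -> ~ caught s r l) ->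
        r m \in A -> caught s r m].

(** One round of a guarding strategy leaves a guarding strategy with delay [n.-1]. As [0.-1] is [0],
    a guard once effective stays so. *)
Lemma guards_step k n A (a : {ffun 'I_k -> G}) v : guards n A a v ->
  occupied a v \/ exists2 a', moves a a' &
    ~ occupied a' v -> (n = 0 -> v \notin A) /\
      forall v', adj v v' -> guards n.-1 A a' v'.
Proof.
move=> [s [s_legal sa sA]]; have [occ|free] := pselect (occupied a v).
  by left.
right; exists (s [:: v]) => [i|free'].
  by rewrite -sa; apply: (s_legal [::]).
split=> [n0|v' vv'].
  apply/negP => vA; have : caught s (fun=> v) 0.
    by apply: sA => //; [move=> ?; apply: adj_refl|rewrite n0].
  by rewrite caughtE /= sa => -[].
exists (fun h => s (v :: h)); split=> // [h w i|r walk_r r0 m nm free_r rA].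
  by rewrite -rcons_cons; apply: s_legal.
(* Putting [v] back in front of the later walk shifts all capture times by one. *)
pose r' l := if l is l'.+1 then r l' else v.
have caughtS l : caught s r' l.+1 <-> caught (fun h => s (v :: h)) r l.
  by rewrite !caughtE 2!(mkseq_cons r').
apply/caughtS; apply: sA => // [||[|l] lm].
- by case=> [|l] //=; rewrite r0.
- by rewrite -(leq_add2r 1) !addn1 in nm; apply: leq_trans nm; case: (n).
- by rewrite caughtE /= sa => -[].
- by move/caughtS; apply: free_r.
Qed.

Lemma guards_set0 k (a : {ffun 'I_k -> G}) v : guards 0 set0 a v.
Proof.
exists (fun=> a); split=> // [h w i|r _ _ m _ _]; first exact: adj_refl.
by rewrite inE.
Qed.

(** * Handing the guard from one team to the other *)

Lemma walk_between (x y : G) : connect (@adj G) x y ->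
  exists w : nat -> G, [/\ w 0 = x, w #|G| = y & forall m, adj (w m) (w m.+1)].
Proof.
move=> /connectP[p0 e_p0 Ey]; move: Ey; case/shortenP: e_p0 => p e_p Up _ Ey.
(* The default [y] makes the walk wait at its end, so all walks last [#|G|] steps and a whole team
   arrives at the same time. *)
exists (nth y (x :: p)); split=> // [|m].
  by rewrite nth_default // -(card_uniqP Up) max_card.
have [mp|pm] := ltnP m (size p); first exact: (pathP y e_p).
rewrite [nth _ _ m.+1]nth_default //; move: pm; rewrite leq_eqVlt.
case/orP=> [/eqP <-|pm]; last by rewrite nth_default //; apply: adj_refl.
by rewrite nth_last Ey; apply: adj_refl.
Qed.

(* The side of each team is tracked by [b], since the teams swap their roles. *)
Definition teams b k (a d : {ffun 'I_k -> G}) : {ffun 'I_(k + k) -> G} :=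
  if b then join a d else join d a.

Lemma occupied_teams b k (a d : {ffun 'I_k -> G}) v :
  occupied (teams b a d) v <-> occupied a v \/ occupied d v.
Proof. by case: b; rewrite occupied_join; tauto. Qed.

Lemma moves_teams b k (a a' d d' : {ffun 'I_k -> G}) :
  moves a a' -> moves d d' -> moves (teams b a d) (teams b a' d').
Proof. by case: b => aa dd; apply: moves_join. Qed.

(** While one team keeps up its guard, the other may make any legal move, and the robber survives
    the round only off [A]. All later inductions on rounds advance by this step. *)
Lemma win_guarding b k A (a d d' : {ffun 'I_k -> G}) v :
    guards 0 A a v -> moves d d' ->
    (forall a' v', ~ occupied d' v -> v \notin A -> adj v v' ->
      guards 0 A a' v' -> win (teams b a' d') v') ->
  win (teams b a d) v.
Proof.
move=> /guards_step[occ|[a' aa' next]] dd' IH.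
  by apply: win_now; rewrite occupied_teams; left.
apply: win_move (moves_teams b aa' dd') _; rewrite occupied_teams => free v' vv'.
have [|vA gA] := next; first by tauto.
by apply: IH => //; [tauto|apply: vA|apply: gA].
Qed.

Section Takeover.
Variables (b : bool) (k : nat) (A J : {set G}) (inv : G -> Prop).
Hypothesis inv_adj : forall v w, v \notin A -> adj v w -> inv v -> inv w.
Hypothesis win_after : forall (a d : {ffun 'I_k -> G}) v, inv v ->
  guards 0 A a v -> guards 0 J d v -> win (teams b a d) v.

Lemma win_setup n (a d : {ffun 'I_k -> G}) v :
  inv v -> guards 0 A a v -> guards n J d v -> win (teams b a d) v.
Proof.
elim: n a d v => [|n IHn] a d v inv_v gA; first exact: win_after.
move=> /guards_step[occ|[d' dd' next]].
  by apply: win_now; rewrite occupied_teams; right.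
apply: win_guarding gA dd' _ => a' v' /next[_ gJ] vA vv' gA.
by apply: IHn => //; [apply: inv_adj vv' inv_v|apply: gJ].
Qed.

(** The second team walks to the initial position of its strategy for [J], then plays it until it
    takes effect; [A] is guarded throughout, so [inv] survives. *)
Lemma win_takeover (hG : connected_graph G) (gJ : can_guard J k)
    (a d : {ffun 'I_k -> G}) v :
  inv v -> guards 0 A a v -> win (teams b a d) v.
Proof.
have [s [s_legal [N sN]]] := gJ.
have /choice[w w_spec] : forall i, exists w : nat -> G,
    [/\ w 0 = d i, w #|G| = s [::] i & forall m, adj (w m) (w m.+1)].
  by move=> i; apply/walk_between/hG.
(* Here [m] counts the walking rounds that remain. *)
suff win_at m : m <= #|G| -> forall a v, inv v -> guards 0 A a v ->
    win (teams b a [ffun i => w i (#|G| - m)]) v.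
  move=> inv_v gA; suff -> : d = [ffun i => w i (#|G| - #|G|)] by apply: win_at.
  by apply/ffunP => i; rewrite ffunE subnn; case: (w_spec i).
elim: m => [|m IHm] mG {}a {}v inv_v gA.
  (* The strategy [s] starts afresh, with the robber's present vertex as his initial one; the delay
     [N] is valid for every walk. *)
  apply: (@win_setup N) => //; exists s; split=> //.
    by apply/ffunP => i; rewrite ffunE subn0; case: (w_spec i).
  by move=> r walk_r _; apply: sN.
apply: (win_guarding (d' := [ffun i => w i (#|G| - m)]) gA).
  by move=> i; rewrite !ffunE -[#|G| - m]prednK ?subn_gt0 // -subnS; case: (w_spec i).
by move=> a' v' _ vA vv'; apply: IHm (ltnW mG) _ _ _; apply: inv_adj vv' inv_v.
Qed.

End Takeover.

Lemma win_caught b k A (a d : {ffun 'I_k -> G}) v :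
  guards 0 A a v -> v \in A -> win (teams b a d) v.
Proof.
move=> gA vA; apply: win_guarding gA (moves_refl d) _ => a' v' _.
by rewrite vA.
Qed.

Lemma teamsC b k (a d : {ffun 'I_k -> G}) : teams b a d = teams (~~ b) d a.
Proof. by case: b. Qed.

(** * The chase along the tree *)

Section TreeDecomposition.
Variables (D : tree_decomposition G) (k : nat).
Hypothesis hG : connected_graph G.
Hypothesis guard_bag : forall i, can_guard (@bag G D i) k.

(** Induction on the size of the branch, with [b] general because the teams swap roles at each
    step. *)
Lemma win_branch b i j (a d : {ffun 'I_k -> G}) v : td_tree i j ->
  confined i j v -> guards 0 (@bag G D i) a v -> win (teams b a d) v.
Proof.
have [n] := ubnP #|branch (@td_tree G D) i j|.
elim: n b i j a d v => // n IHn b i j a d v; rewrite ltnS => card_n tij.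
apply: (win_takeover _ _ hG (guard_bag j)) => {a d v} [v w|a d v [l vl il] gi gj].
  exact: confined_adj.
have [vj|vj] := boolP (v \in bag j).
  by rewrite teamsC; apply: win_caught gj vj.
have lj : l != j by apply: contra vj => /eqP <-.
(* The step from [j] towards the robber's bag [l] is taken in [away i], as [branch_proper] requires.
   The guard [gi] is then dropped, which releases the first team. *)
move: il; rewrite inE => /(@connect_first_step _ (@td_tree G D)).
case=> [x y /andP[]|//|j' jj' lj'] //; rewrite teamsC.
apply: (IHn _ j j') => //; last by exists l.
- exact: leq_trans (proper_card (branch_proper (td_is_tree D) tij jj')) card_n.
- by case/andP: jj'.
Qed.

Lemma win_teams (a d : {ffun 'I_k -> G}) v : win (join a d) v.
Proof.
have [/card_gt0P[i _] _ _ cT _] := td_is_tree D.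
(* At the start one team trivially guards the empty set while the other takes an arbitrary first
   bag. *)
apply: (@win_takeover true _ set0 (bag i) (fun=> True)) (guards_set0 a v) => //.
move=> {a d v} a d v _ _ gi; rewrite teamsC.
have [vi|vi] := boolP (v \in bag i); first exact: win_caught gi vi.
have [l vl] := td_vertex D v.
have li : l != i by apply: contra vi => /eqP <-.
have [j tij lj] := connect_first_step (fun x y => id) (cT i l) li.
by apply: win_branch tij _ gi; exists l.
Qed.

End TreeDecomposition.

End Game.

Theorem theorem1 (G : graph) (hG : connected_graph G) :
  cop_number G <= 2 * min_rcc_width G.
Proof.
rewrite /cop_number; case: ex_minnP => c _ c_min.
have [x _|G0] := pickP (@predT G); last first.
  (* On the empty graph no cop can be placed, but there is no robber walk either, so zero cops
     win. *)
  suff c0 : c <= 0 by apply: leq_trans c0 _.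
  apply/c_min/asboolP; exists (fun=> [ffun i : 'I_0 => False_rect G (notF (ltn_ord i))]).
  by split=> [h v []|r]; last by have := G0 (r 0).
rewrite /min_rcc_width; case: ex_minnP => m /asboolP[D <-] _.
apply/c_min/asboolP; rewrite mul2n -addnn.
apply: (@cops_win_from _ _ (join [ffun=> x] [ffun=> x])) => v.
apply: (@win_teams _ D) => // i; apply: (can_guard_rcc x).
exact: (leq_bigmax i).
Qed.
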